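(* For a sequence $a=(a_k)_{k\ge1}\in\omega$ let $V=V(a)=(v_{nk})_{n,k\ge1}$ be the infinite matrix with $$v_{nk}=\begin{cases}ka_k-(k+1)a_{k+1}, & k<n,\\ na_n, & k=n,\\ 0, & k>n.\end{cases}$$ Then $$[c_0(\Gamma)]^\beta=\{a\in\omega: V\in(c_0:c)\},\quad [c(\Gamma)]^\beta=\{a\in\omega: V\in(c:c)\},\quad [\ell_\infty(\Gamma)]^\beta=\{a\in\omega: V\in(\ell_\infty:c)\},$$ $$[c_0(\Gamma)]^\gamma=\{a\in\omega: V\in(c_0:\ell_\infty)\},\quad [c(\Gamma)]^\gamma=\{a\in\omega: V\in(c:\ell_\infty)\},\quad [\ell_\infty(\Gamma)]^\gamma=\{a\in\omega: V\in(\ell_\infty:\ell_\infty)\}.$$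
   Context: $\omega$ is the space of all real (or complex) sequences $x=(x_k)_{k\ge1}$; $\ell_\infty$, $c$, $c_0$ are the spaces of bounded, convergent and null sequences; $cs$ and $bs$ are the spaces of sequences whose series of partial sums $\left(\sum_{k=1}^n x_k\right)_n$ is convergent, respectively bounded. The infinite matrix $\Gamma=(b_{nk})_{n,k\ge1}$ has $b_{nk}=1/k$ for $1\le k\le n$ and $b_{nk}=0$ for $k>n$, so $(\Gamma x)_n=\sum_{k=1}^n k^{-1}x_k$, and for $X\in\{\ell_\infty,c,c_0\}$, $X(\Gamma)=\{x\in\omega:\Gamma x\in X\}$. For $X\subset\omega$, the $\beta$-dual is $X^\beta=\{a\in\omega:(a_kx_k)_k\in cs\text{ for all }x\in X\}$ and the $\gamma$-dual is $X^\gamma=\{a\in\omega:(a_kx_k)_k\in bs\text{ for all }x\in X\}$. $(X:Y)$ denotes the class of infinite matrices $A=(a_{nk})$ such that for every $x\in X$ the series $(Ax)_n=\sum_k a_{nk}x_k$ converges for every $n$ and $Ax=((Ax)_n)_n\in Y$. *)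

(* Defs.v *)
From mathcomp Require Export all_boot all_order all_algebra.
From mathcomp Require Export complex.
From mathcomp Require Export all_classical all_reals all_analysis.

Set Implicit Arguments.
Unset Strict Implicit.
Unset Printing Implicit Defensive.
Export Order.TTheory GRing.Theory Num.Theory.
Export numFieldNormedType.Exports.
Local Open Scope classical_set_scope.
Local Open Scope ring_scope.

(* Indices are shifted by one: a sequence (x_k)_(k >= 1) is encoded as
   x : nat -> K with x k standing for x_(k+1), and likewise for both indices
   of an infinite matrix. *)

Section SequenceSpaces.
Variable K : numFieldType.
Implicit Types (x a : K^nat) (X Y : set K^nat) (A : nat -> nat -> K).

Definition linfty : set K^nat := [set x | bounded_fun x].
Definition conv : set K^nat := [set x | cvgn x].
Definition null : set K^nat := [set x | x @ \oo --> (0 : K)].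

(* [series x n] is the sum of the first n terms; the additional empty sum at
   n = 0 affects neither convergence nor boundedness. *)
Definition cs : set K^nat := [set x | conv (series x)].
Definition bs : set K^nat := [set x | linfty (series x)].

(* [limn] is a default value on divergent sequences, hence the explicit
   convergence condition in [mx_domain]. *)
Definition mx_transform A x : K^nat :=
  fun n => limn (series (fun k => A n k * x k)).

Definition mx_domain X A : set K^nat :=
  [set x | (forall n, cvgn (series (fun k => A n k * x k)))
           /\ X (mx_transform A x)].

Definition mx_class X Y : set (nat -> nat -> K) :=
  [set A | X `<=` mx_domain Y A].

Definition beta_dual X : set K^nat :=
  [set a | forall x, X x -> cs (fun k => a k * x k)].

Definition gamma_dual X : set K^nat :=
  [set a | forall x, X x -> bs (fun k => a k * x k)].

Definition Gamma_mx (n k : nat) : K :=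
  if (k <= n)%N then k.+1%:R^-1 else 0.

Definition V_mx a (n k : nat) : K :=
  if (k < n)%N then k.+1%:R * a k - k.+2%:R * a k.+1
  else if k == n then n.+1%:R * a n
  else 0.

End SequenceSpaces.

Arguments linfty {K}.
Arguments conv {K}.
Arguments null {K}.
Arguments cs {K}.
Arguments bs {K}.
Arguments Gamma_mx {K}.

(* Main.v *)
(* Summation by parts: if y = Gamma x, that is, x_k = k (y_k - y_(k-1)) with
   y_0 = 0, then the partial sums of (a_k x_k) are exactly the terms of V(a) y.
   As Gamma is a bijection of omega, the dual conditions on x in X(Gamma) are
   conditions on V(a) y for y in X. *)
Require Import Defs.
From mathcomp Require Import ring.
Local Open Scope classical_set_scope.
Local Open Scope ring_scope.

Section GammaDuals.
Variable K : numFieldType.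
Implicit Types (x y a u : K^nat) (X Y : set K^nat).

Lemma cvg_series_finite_support u (n : nat) :
  (forall k, (n <= k)%N -> u k = 0) -> series u @ \oo --> series u n.
Proof.
move=> u0; apply: cvg_near_cst; exists n => // m /= nm.
rewrite /series /= (big_cat_nat _ nm) //= [X in _ + X]big1_seq ?addr0 //.
by move=> k /andP[_]; rewrite mem_index_iota => /andP[/u0].
Qed.

Definition lower_triangular (A : nat -> nat -> K) :=
  forall n k, (n < k)%N -> A n k = 0.

Lemma cvg_lower_triangular A x n : lower_triangular A ->
  series (fun k => A n k * x k) @ \oo --> \sum_(0 <= k < n.+1) A n k * x k.
Proof.
by move=> A0; apply: cvg_series_finite_support => k nk; rewrite A0 ?mul0r.
Qed.

Lemma mx_transform_lower_triangular A x n : lower_triangular A ->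
  mx_transform A x n = \sum_(0 <= k < n.+1) A n k * x k.
Proof. by move=> A0; apply: cvg_lim => //; exact: cvg_lower_triangular. Qed.

(** Each row of [A] has finite support, so the convergence demanded by [mx_domain] is automatic and
    [limn] never takes its default value. *)
Lemma mx_domain_lower_triangular X A x : lower_triangular A ->
  mx_domain X A x <-> X (mx_transform A x).
Proof.
move=> A0; split=> [[]//|Xx]; split=> // n.
by apply: cvgP; exact: cvg_lower_triangular.
Qed.

Lemma Gamma_mx_lower_triangular : lower_triangular (@Gamma_mx K).
Proof. by move=> n k nk; rewrite /Gamma_mx leqNgt nk. Qed.

Lemma V_mx_lower_triangular a : lower_triangular (V_mx a).
Proof. by move=> n k nk; rewrite /V_mx ltnNge ltnW //= gtn_eqF. Qed.

Lemma Gamma_transformE x n :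
  mx_transform Gamma_mx x n = \sum_(0 <= k < n.+1) k.+1%:R^-1 * x k.
Proof.
rewrite mx_transform_lower_triangular; last exact: Gamma_mx_lower_triangular.
by apply: eq_big_nat => k /andP[_ kn]; rewrite /Gamma_mx -ltnS kn.
Qed.

Definition Gamma_inv y : K^nat :=
  fun n => n.+1%:R * (y n - if n is m.+1 then y m else 0).

(** The sum telescopes. This gives surjectivity: every [y] in [X] is the transform of some [x] in
    the domain of [X]. *)
Lemma Gamma_invK y : mx_transform Gamma_mx (Gamma_inv y) = y.
Proof.
apply/funext => n; rewrite Gamma_transformE.
elim: n => [|n IHn].
  by rewrite big_nat1 /Gamma_inv mulKf ?pnatr_eq0 // subr0.
by rewrite big_nat_recr //= IHn /Gamma_inv mulKf ?pnatr_eq0 // addrC subrK.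
Qed.

Lemma V_transformE a y n : mx_transform (V_mx a) y n =
  \sum_(0 <= k < n) (k.+1%:R * a k - k.+2%:R * a k.+1) * y k
  + n.+1%:R * a n * y n.
Proof.
rewrite mx_transform_lower_triangular; last exact: V_mx_lower_triangular.
rewrite big_nat_recr //= /V_mx ltnn eqxx; congr (_ + _).
by apply: eq_big_nat => k /andP[_ ->].
Qed.

(** With [y] the transform of [x], passing from row [n] to row [n.+1] adds
    [n.+2%:R * a n.+1 * (y n.+1 - y n)], which is [a n.+1 * x n.+1]. Row [n] matches [n.+1] summands
    because indices start at 0. *)
Lemma V_Gamma_transform a x n :
  mx_transform (V_mx a) (mx_transform Gamma_mx x) n
  = series (fun k => a k * x k) n.+1.
Proof.
rewrite V_transformE /series /=; elim: n => [|n IHn].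
  rewrite big_nil add0r Gamma_transformE !big_nat1 invr1; ring.
rewrite [RHS]big_nat_recr //= -IHn big_nat_recr //=.
have -> : mx_transform Gamma_mx x n.+1
    = mx_transform Gamma_mx x n + n.+2%:R^-1 * x n.+1.
  by rewrite !Gamma_transformE big_nat_recr.
rewrite [n.+2%:R * _ * (_ + _)]mulrDr mulrACA mulfV ?pnatr_eq0 // mul1r; ring.
Qed.

(** Absorbs the empty sum [series _ 0], which has no counterpart among the rows of [V_mx a]. *)
Definition shift_stable Y := forall u, Y u <-> Y (fun n => u n.+1).

Lemma conv_shift_stable : shift_stable conv.
Proof.
move=> u; split=> /cvg_ex[l ul]; apply/cvg_ex; exists l.
  by rewrite (cvg_shiftS u).
by rewrite -(cvg_shiftS u).
Qed.

Lemma linfty_shift_stable : shift_stable linfty.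
Proof.
move=> u; split=> -[M [Mreal uM]].
  by exists M; split=> // B /uM uB n _; exact: uB.
(* The bound must also cover the restored term [u 0]. The order on [K] may be partial, so
   comparability comes from both arguments being real. *)
exists (Num.max M `|u 0|); split; first by rewrite max_real ?normr_real.
move=> B; rewrite comparable_gt_max ?real_comparable ?normr_real //.
move=> /andP[/uM uB u0B] [|n] _ /=.
  exact: ltW.
exact: uB.
Qed.

Lemma Gamma_domain_dual X Y : shift_stable Y ->
  [set a | forall x, mx_domain X Gamma_mx x -> Y (series (fun k => a k * x k))]
  = [set a | mx_class X Y (V_mx a)].
Proof.
move=> Yshift; apply/seteqP; split=> a /= aXY.
  move=> y Xy; apply/mx_domain_lower_triangular.
    exact: V_mx_lower_triangular.
  (* Test [a] on the preimage of [y]. *)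
  have /Yshift : Y (series (fun k => a k * Gamma_inv y k)).
    apply: aXY; apply/mx_domain_lower_triangular.
      exact: Gamma_mx_lower_triangular.
    by rewrite Gamma_invK.
  by under eq_fun do rewrite -V_Gamma_transform Gamma_invK.
(* Conversely, apply the matrix to the transform of [x], which lies in [X]. *)
move=> x [_ /aXY[_ VY]]; apply/Yshift.
by under eq_fun do rewrite -V_Gamma_transform.
Qed.

End GammaDuals.

Theorem theorem3p6 (R : realType) :
  (* real sequences *)
  (
    (beta_dual (mx_domain null Gamma_mx) =
       [set a : R^nat | mx_class null conv (V_mx a)]) /\
    (beta_dual (mx_domain conv Gamma_mx) =
       [set a : R^nat | mx_class conv conv (V_mx a)]) /\
    (beta_dual (mx_domain linfty Gamma_mx) =
       [set a : R^nat | mx_class linfty conv (V_mx a)]) /\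
    (gamma_dual (mx_domain null Gamma_mx) =
       [set a : R^nat | mx_class null linfty (V_mx a)]) /\
    (gamma_dual (mx_domain conv Gamma_mx) =
       [set a : R^nat | mx_class conv linfty (V_mx a)]) /\
    (gamma_dual (mx_domain linfty Gamma_mx) =
       [set a : R^nat | mx_class linfty linfty (V_mx a)])
  ) /\
  (* complex sequences *)
  (
    (beta_dual (mx_domain null Gamma_mx) =
       [set a : (complex R)^nat | mx_class null conv (V_mx a)]) /\
    (beta_dual (mx_domain conv Gamma_mx) =
       [set a : (complex R)^nat | mx_class conv conv (V_mx a)]) /\
    (beta_dual (mx_domain linfty Gamma_mx) =
       [set a : (complex R)^nat | mx_class linfty conv (V_mx a)]) /\
    (gamma_dual (mx_domain null Gamma_mx) =
       [set a : (complex R)^nat | mx_class null linfty (V_mx a)]) /\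
    (gamma_dual (mx_domain conv Gamma_mx) =
       [set a : (complex R)^nat | mx_class conv linfty (V_mx a)]) /\
    (gamma_dual (mx_domain linfty Gamma_mx) =
       [set a : (complex R)^nat | mx_class linfty linfty (V_mx a)])
  ).
Proof.
(* Both duals unfold to the set in [Gamma_domain_dual], with [Y] equal to [conv] for beta and
   [linfty] for gamma. *)
by do !split; apply: Gamma_domain_dual;
  (exact: conv_shift_stable || exact: linfty_shift_stable).
Qed.
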